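(* Let $-1<a<1$, $b\in\mathbb{R}$, and $0<z<\frac{\pi}{6}$. Then $$\sum_{n=1}^\infty \frac{(1-e^{-2iz})^n}{n+a}\prod_{k=1}^{n-1}\frac{k-b+\frac{a}{2}}{k+a} = 2i\int_0^z \exp\left(a\log\left(\frac{\sin t}{\sin z}\right)\right)\exp\left(2ib(t-z)\right)dt.$$
   Context: Here $i$ is the imaginary unit, $\log$ is the real logarithm of the positive number $\sin t/\sin z$, empty products equal $1$, and for $a<0$ the integral is an (absolutely convergent) improper integral at $t=0$. *)

(* Defs.v *)
From Stdlib Require Import Reals List.
From Coquelicot Require Import Coquelicot.
Open Scope R_scope.

(* e^(x + iy) = e^x (cos y + i sin y) *)
Definition Cexp (w : C) : C :=
  (exp (Re w) * cos (Im w), exp (Re w) * sin (Im w)).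

(* f m * f (m + 1) * ... * f (n - 1), equal to 1 when n <= m *)
Definition prod_nat (f : nat -> R) (m n : nat) : R :=
  fold_right Rmult 1 (map f (seq m (n - m))).

(* l is the absolutely convergent integral of f over ]p, q], improper at p;
   neither the value of f at p nor its boundedness near p plays a role. *)
Definition is_abs_RInt_right (f : R -> C) (p q : R) (l : C) : Prop :=
  ex_RInt_gen (fun t => Cmod (f t)) (at_right p) (at_point q) /\
  is_RInt_gen (V := C_R_NormedModule) f (at_right p) (at_point q) l.

(* Main.v *)
Require Import Defs.
From Stdlib Require Import Reals List Lra Lia.
From Coquelicot Require Import Coquelicot.
Open Scope R_scope.

(** Put [w t = 1 - exp (-2it)].  Viewed as a function of [w], the series
    satisfies a first order linear differential equation in [w]; in the
    variable [t] it reads [S' + (a cot t + 2ib) S = 2i], and the weight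
    [E t = (sin t / sin z)^a exp (2ib (t - z))], which satisfies
    [E' = (a cot t + 2ib) E], is an integrating factor: [(S E)' = 2i E].
    Since [S E] vanishes at [0] and [E z = 1], integration over [(0, z]] gives
    the identity.

    To avoid differentiating a complex power series term by term, the argument
    is run on the partial sums.  The [N]-th one, [S_N], satisfies the same
    equation up to one monomial,
    [(S_N E)' = 2i E (1 - r_N)] with [r_N = p_(N+1) w^(N+1)] and
    [p_m = prod_(1 <= k <= m) (k - b + a/2) / (k + a)]
    ([partial_sum_identity], [is_derive_partial_sum_weight]).  Integrating,
    [S_N z - 2i int E = - 2i int E r_N], which is at most
    [2 |p_(N+1)| (2 sin z)^(N+1) int |E|] because [|w t| = 2 sin t] is
    increasing ([partial_sum_error]).  The ratio of consecutive values of
    [p_m (2 sin z)^m] tends to [2 sin z], which is less than [1] exactly because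
    [z < PI / 6], so the error tends to [0] ([is_lim_seq_ratio_prod_pow]).

    The integrals converge at [0] because [|E t| = (sin t / sin z)^a] is
    bounded, up to a constant, by the derivative of [(sin t / sin z)^(1 + a)],
    which tends to [0] at [0] as [1 + a > 0]
    ([ex_RInt_gen_sin_ratio_power]). *)

(** * Complex valued functions of a real variable *)

(** The real normed module [C] of the theorem, bundled with its completeness:
    the fundamental theorem of calculus and the Cauchy criterion are stated for
    complete modules. *)
Definition C_R_CompleteNormedModule : CompleteNormedModule R_AbsRing :=
  CompleteNormedModule.Pack R_AbsRing C
    (CompleteNormedModule.Class R_AbsRing C
      (NormedModule.class R_AbsRing C_R_NormedModule)
      (CompleteNormedModule.mixin C_AbsRing C
        (CompleteNormedModule.class C_AbsRing C_CompleteNormedModule))) C.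

Lemma norm_C_R (x : C) : @norm R_AbsRing C_R_NormedModule x = Cmod x.
Proof.
  unfold Cmod, norm; simpl; unfold prod_norm, norm; simpl; unfold abs; simpl.
  f_equal. destruct x as [x y]; simpl.
  generalize (Rsqr_abs x), (Rsqr_abs y); unfold Rsqr; intros; lra.
Qed.

(** Lets a derivative be computed by unification first and compared with the
    wanted value afterwards. *)
Lemma is_derive_eq_value {V : NormedModule R_AbsRing} (f : R -> V) (t : R) (l l' : V) :
  is_derive f t l -> l = l' -> is_derive f t l'.
Proof. intros Hf <-. exact Hf. Qed.

(** Restates an equation between elements of the module [C_R_NormedModule] in
    the vocabulary of the field [C], where [ring] and [field] apply. *)
Ltac C_equation :=
  match goal with |- @eq _ ?l ?r => change (@eq C l r) end; cbv beta;
  change (@zero C_R_NormedModule) with (RtoC 0);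
  change (@plus C_R_NormedModule) with Cplus.

Lemma is_derive_pair (f g : R -> R) (t f' g' : R) :
  is_derive f t f' -> is_derive g t g' ->
  is_derive (V := C_R_NormedModule) (fun s => (f s, g s)) t (f', g').
Proof.
  intros Hf Hg.
  refine (filterdiff_comp'_2 (W := C_R_NormedModule) f g (fun x y => (x, y)) t
            _ _ (fun x y => (x, y)) Hf Hg _).
  apply filterdiff_linear, is_linear_prod; [apply is_linear_fst | apply is_linear_snd].
Qed.

Lemma is_derive_Re (f : R -> C) (t : R) (l : C) :
  is_derive (V := C_R_NormedModule) f t l -> is_derive (fun s => Re (f s)) t (Re l).
Proof.
  intros Hf.
  apply (filterdiff_comp' (V := C_R_NormedModule) f fst t _ fst Hf).
  apply filterdiff_linear, is_linear_fst.
Qed.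

Lemma is_derive_Im (f : R -> C) (t : R) (l : C) :
  is_derive (V := C_R_NormedModule) f t l -> is_derive (fun s => Im (f s)) t (Im l).
Proof.
  intros Hf.
  apply (filterdiff_comp' (V := C_R_NormedModule) f snd t _ snd Hf).
  apply filterdiff_linear, is_linear_snd.
Qed.

Lemma is_derive_RtoC (f : R -> R) (t l : R) :
  is_derive f t l -> is_derive (V := C_R_NormedModule) (fun s => RtoC (f s)) t (RtoC l).
Proof.
  intros Hf. apply is_derive_pair; [exact Hf | apply (is_derive_const (K := R_AbsRing) (V := R_NormedModule))].
Qed.

(** For the base field [R] the product of [C] is a bilinear map, not the
    multiplication of scalars; its product rule is read off from the real and
    imaginary parts. *)
Lemma is_derive_Cmult (f g : R -> C) (t : R) (f' g' : C) :
  is_derive (V := C_R_NormedModule) f t f' ->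
  is_derive (V := C_R_NormedModule) g t g' ->
  is_derive (V := C_R_NormedModule) (fun s => f s * g s)%C t (f' * g t + f t * g')%C.
Proof.
  intros Hf Hg.
  pose proof (is_derive_Re _ _ _ Hf) as Hf1. pose proof (is_derive_Im _ _ _ Hf) as Hf2.
  pose proof (is_derive_Re _ _ _ Hg) as Hg1. pose proof (is_derive_Im _ _ _ Hg) as Hg2.
  apply is_derive_pair; eapply is_derive_eq_value.
  - apply (is_derive_minus (V := R_NormedModule)); apply Derive.is_derive_mult; eassumption.
  - simpl; unfold minus, plus, opp, Re, Im; simpl; ring.
  - apply (is_derive_plus (V := R_NormedModule)); apply Derive.is_derive_mult; eassumption.
  - simpl; unfold plus, Re, Im; simpl; ring.
Qed.

Lemma is_derive_Cpow (f : R -> C) (t : R) (f' : C) (n : nat) :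
  is_derive (V := C_R_NormedModule) f t f' ->
  is_derive (V := C_R_NormedModule) (fun s => f s ^ S n)%C t
    (RtoC (INR (S n)) * f t ^ n * f')%C.
Proof.
  intros Hf. induction n as [|n IH].
  - eapply is_derive_ext; [intros s; symmetry; apply Cmult_1_r|].
    replace (RtoC (INR 1) * f t ^ 0 * f')%C with f' by (simpl; ring). exact Hf.
  - replace (RtoC (INR (S (S n))) * f t ^ S n * f')%C
      with (f' * f t ^ S n + f t * (RtoC (INR (S n)) * f t ^ n * f'))%C.
    + exact (is_derive_Cmult _ _ _ _ _ Hf IH).
    + rewrite (S_INR (S n)), RtoC_plus. simpl. ring.
Qed.

Lemma is_derive_Cexp (f : R -> C) (t : R) (f' : C) :
  is_derive (V := C_R_NormedModule) f t f' ->
  is_derive (V := C_R_NormedModule) (fun s => Cexp (f s)) t (f' * Cexp (f t))%C.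
Proof.
  intros Hf.
  pose proof (is_derive_Re _ _ _ Hf) as Hf1. pose proof (is_derive_Im _ _ _ Hf) as Hf2.
  assert (Hexp : is_derive (fun s => exp (Re (f s))) t (Re f' * exp (Re (f t))))
    by exact (is_derive_comp exp _ t _ _ (is_derive_exp _) Hf1).
  assert (Hcos := is_derive_comp cos _ t _ _ (is_derive_cos _) Hf2).
  assert (Hsin := is_derive_comp sin _ t _ _ (is_derive_sin _) Hf2).
  apply is_derive_pair; eapply is_derive_eq_value.
  - apply Derive.is_derive_mult; eassumption.
  - unfold Cexp, scal, Re, Im; simpl; unfold mult; simpl; ring.
  - apply Derive.is_derive_mult; eassumption.
  - unfold Cexp, scal, Re, Im; simpl; unfold mult; simpl; ring.
Qed.

(** * Integrals that are improper at the left endpoint *)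

Lemma is_RInt_gen_right {V : NormedModule R_AbsRing} (f : R -> V) (J : R -> V)
    (p q : R) (l : V) :
  p < q ->
  (forall x, p < x <= q -> is_RInt f x q (J x)) ->
  filterlim J (at_right p) (locally l) ->
  is_RInt_gen f (at_right p) (at_point q) l.
Proof.
  intros Hpq HJ Hl P HP.
  unfold filtermapi.
  apply (Filter_prod _ _ _ (fun x => p < x <= q /\ P (J x)) (fun y => y = q)).
  - apply filter_and.
    + exists (mkposreal (q - p) ltac:(lra)). intros y Hy Hpy.
      apply Rabs_lt_between' in Hy. simpl in Hy. lra.
    + exact (Hl P HP).
  - reflexivity.
  - intros x y [Hx HPx] ->. exists (J x). split; [exact (HJ x Hx) | exact HPx].
Qed.

(** Comparison test.  Between two lower endpoints the integral of [f] changes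
    by at most the variation of the primitive [Phi] of the dominating function,
    so the Cauchy property of [Phi] at [p] passes to the integral of [f]. *)
Lemma ex_RInt_gen_dominated {V : CompleteNormedModule R_AbsRing} (f : R -> V)
    (Phi phi : R -> R) (p q l : R) :
  p < q ->
  (forall x, p < x <= q -> continuous f x) ->
  (forall x, p < x <= q -> is_derive Phi x (phi x)) ->
  (forall x, p < x <= q -> continuous phi x) ->
  (forall x, p < x <= q -> norm (f x) <= phi x) ->
  filterlim Phi (at_right p) (locally l) ->
  ex_RInt_gen f (at_right p) (at_point q).
Proof.
  intros Hpq Hf HPhi Hphi Hle Hl.
  assert (Hex : forall x y, p < x <= q -> p < y <= q -> ex_RInt f x y).
  { intros x y Hx Hy. apply (ex_RInt_continuous (V := V)). intros t Ht. apply Hf.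
    unfold Rmin, Rmax in Ht; destruct (Rle_dec x y); lra. }
  assert (Hbound : forall x y, p < x -> x <= y -> y <= q ->
            norm (minus (RInt f x q) (RInt f y q)) <= Rabs (Phi y - Phi x)).
  { intros x y Hx Hxy Hy.
    replace (minus (RInt f x q) (RInt f y q)) with (RInt f x y).
    2: { rewrite <- (RInt_Chasles f x y q) by (apply Hex; lra).
         unfold minus. etransitivity; [|apply plus_assoc].
         etransitivity; [symmetry; apply plus_zero_r|].
         f_equal. symmetry.
         apply (plus_opp_r (G := CompleteNormedModule.AbelianGroup R_AbsRing V)). }
    apply Rle_trans with (2 := Rle_abs _).
    apply (norm_RInt_le f phi x y _ _ Hxy).
    - intros t Ht; apply Hle; lra.
    - apply RInt_correct, Hex; lra.
    - change (Phi y - Phi x) with (minus (Phi y) (Phi x)).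
      apply (is_RInt_derive (V := R_CompleteNormedModule)); intros t;
        rewrite Rmin_left, Rmax_right by lra; intros Ht; [apply HPhi | apply Hphi]; lra. }
  destruct (proj1 (filterlim_locally_cauchy (F := at_right p) (fun x => RInt f x q)))
    as [I HI].
  - intros eps.
    destruct (proj2 (filterlim_locally_cauchy (F := at_right p) Phi)
                (ex_intro _ l Hl) eps) as [P [HP Hc]].
    exists (fun x => p < x <= q /\ P x). split.
    + apply filter_and; [|exact HP].
      exists (mkposreal (q - p) ltac:(lra)). intros y Hy Hpy.
      apply Rabs_lt_between' in Hy. simpl in Hy. lra.
    + assert (Hw : forall u v, p < u <= q -> p < v <= q -> u <= v -> P u -> P v ->
                ball (RInt f v q) eps (RInt f u q)).
      { intros u v Hu Hv Huv HPu HPv.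
        apply (norm_compat1 (V := CompleteNormedModule.NormedModule R_AbsRing V)).
        apply Rle_lt_trans with (1 := Hbound u v ltac:(lra) Huv ltac:(lra)).
        exact (Hc u v HPu HPv). }
      intros u v [Hu HPu] [Hv HPv]. destruct (Rle_dec u v).
      * apply ball_sym, Hw; lra || assumption.
      * apply Hw; lra || assumption.
  - exists I. apply is_RInt_gen_right
      with (2 := fun x Hx => RInt_correct f x q (Hex x q Hx ltac:(lra)));
      assumption.
Qed.

(** * The partial sums and the differential equation *)

Definition one_minus_phase (t : R) : C := (1 - Cexp (- (2 * Ci * RtoC t)))%C.

Definition ratio_prod (a b : R) (m : nat) : R :=
  prod_nat (fun k => (INR k - b + a / 2) / (INR k + a)) 1 (S m).

Definition series_term (a b t : R) (m : nat) : C :=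
  (one_minus_phase t ^ S m / RtoC (INR (S m) + a) * RtoC (ratio_prod a b m))%C.

Definition partial_sum (a b : R) (N : nat) (t : R) : C :=
  sum_n (G := C_R_NormedModule) (series_term a b t) N.

(** The relative defect [r_N]: the partial sum satisfies the differential
    equation of the series with the right side multiplied by [1 - r_N]. *)
Definition tail_factor (a b t : R) (N : nat) : C :=
  (RtoC (ratio_prod a b (S N)) * one_minus_phase t ^ S N)%C.

Definition weight (a b z t : R) : C :=
  (RtoC (exp (a * ln (sin t / sin z))) *
   Cexp (2 * Ci * RtoC b * RtoC (t - z)%R))%C.

Lemma one_minus_phase_trig (t : R) :
  one_minus_phase t = (2 * sin t * sin t, 2 * sin t * cos t).
Proof.
  unfold one_minus_phase, Cexp. simpl.
  replace (- ((2 * 0 - 0 * 1) * t - (2 * 1 + 0 * 0) * 0)) with 0 by ring.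
  replace (- ((2 * 0 - 0 * 1) * 0 + (2 * 1 + 0 * 0) * t)) with (- (2 * t)) by ring.
  rewrite exp_0, cos_neg, sin_neg, cos_2a_sin, sin_2a.
  unfold Cminus, Cplus, Copp, RtoC; simpl. f_equal; ring.
Qed.

Lemma Cmod_one_minus_phase (t : R) : 0 <= sin t -> Cmod (one_minus_phase t) = 2 * sin t.
Proof.
  intros Ht. rewrite one_minus_phase_trig. unfold Cmod; simpl.
  replace (_ + _) with (4 * Rsqr (sin t) * ((sin t)² + (cos t)²)) by (unfold Rsqr; ring).
  rewrite sin2_cos2, Rmult_1_r.
  replace (4 * Rsqr (sin t)) with (Rsqr (2 * sin t)) by (unfold Rsqr; ring).
  apply sqrt_Rsqr; lra.
Qed.

Lemma one_minus_phase_neq_0 (t : R) : 0 < sin t -> one_minus_phase t <> 0%C.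
Proof.
  intros Ht H. assert (E := Cmod_one_minus_phase t ltac:(lra)).
  rewrite H, Cmod_0 in E. lra.
Qed.

(** The relation that turns the coefficient [a / w] of the equation in [w] into
    the [a cot t] of the equation in [t]. *)
Lemma one_minus_phase_cot (t : R) :
  sin t <> 0 ->
  (one_minus_phase t * (RtoC (cos t / sin t) + Ci) = 2 * Ci)%C.
Proof.
  intros Ht. rewrite one_minus_phase_trig.
  assert (E := sin2_cos2 t). unfold Rsqr in E.
  apply injective_projections; simpl; field_simplify; auto; nra.
Qed.

Lemma is_derive_one_minus_phase (t : R) :
  is_derive (V := C_R_NormedModule) one_minus_phase t
    (2 * Ci * (1 - one_minus_phase t))%C.
Proof.
  eapply is_derive_eq_value.
  - apply (is_derive_minus (V := C_R_NormedModule)).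
    + apply (is_derive_const (V := C_R_NormedModule)).
    + apply is_derive_Cexp. apply (is_derive_opp (V := C_R_NormedModule)).
      apply is_derive_Cmult; [apply (is_derive_const (V := C_R_NormedModule))|].
      apply is_derive_RtoC, (is_derive_id (K := R_AbsRing)).
  - change (0 - ((- (0 * RtoC t + 2 * Ci * RtoC 1)) * Cexp (- (2 * Ci * RtoC t))) =
            2 * Ci * (1 - one_minus_phase t))%C.
    unfold one_minus_phase. ring.
Qed.

Lemma ratio_prod_S (a b : R) (m : nat) :
  ratio_prod a b (S m) =
  ratio_prod a b m * ((INR (S m) - b + a / 2) / (INR (S m) + a)).
Proof.
  unfold ratio_prod, prod_nat.
  replace (S (S m) - 1)%nat with (S (S m - 1)) by lia.
  rewrite seq_S, map_app, fold_right_app.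
  replace (1 + (S m - 1))%nat with (S m) by lia.
  generalize (seq 1 (S m - 1)); intros s.
  set (f := fun k => (INR k - b + a / 2) / (INR k + a)).
  change (fold_right Rmult (f (S m) * 1) (map f s) = fold_right Rmult 1 (map f s) * f (S m)).
  generalize (f (S m)); intros x.
  induction s as [|y s IH]; simpl; [ring | rewrite IH; ring].
Qed.

Lemma INR_S_plus_neq_0 (a : R) (m : nat) : -1 < a -> INR (S m) + a <> 0.
Proof. rewrite S_INR. generalize (pos_INR m). lra. Qed.

(** The equation [w (1 - w) S' + (a - c w) S = w], [c = a/2 - b], for the
    partial sums; the first sum is the derivative with respect to [w].  The
    recurrence of the coefficients makes the contribution of the [m]-th term
    telescope: it is [w (p_m w^m - p_(m+1) w^(m+1))]. *)
Lemma partial_sum_identity (a b t : R) (N : nat) :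
  -1 < a ->
  let w := one_minus_phase t in
  (w * (1 - w) *
     sum_n (G := C_R_NormedModule) (fun m => RtoC (INR (S m)) * w ^ m *
        (RtoC (ratio_prod a b m) / RtoC (INR (S m) + a)))%C N +
   (RtoC a - RtoC (a / 2 - b) * w) * partial_sum a b N t =
   w * (1 - tail_factor a b t N))%C.
Proof.
  intros Ha w. unfold partial_sum, tail_factor, series_term. fold w.
  assert (Hrec : forall m, (RtoC (ratio_prod a b (S m)) * (RtoC (INR (S m)) + RtoC a) =
            RtoC (ratio_prod a b m) * (RtoC (INR (S m)) + RtoC (a / 2 - b)))%C).
  { intros m. rewrite <- !RtoC_plus, <- !RtoC_mult, ratio_prod_S. f_equal.
    field. apply INR_S_plus_neq_0, Ha. }
  assert (Hne : forall m, (RtoC (INR (S m)) + RtoC a <> 0)%C).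
  { intros m. rewrite <- RtoC_plus. intros E. apply (INR_S_plus_neq_0 a m Ha).
    exact (RtoC_inj _ _ E). }
  assert (Hstep : forall m (v : C),
    (w * (1 - w) * (RtoC (INR (S m)) * v * (RtoC (ratio_prod a b m) / RtoC (INR (S m) + a))) +
     (RtoC a - RtoC (a / 2 - b) * w) *
       (w * v / RtoC (INR (S m) + a) * RtoC (ratio_prod a b m)) =
     w * (RtoC (ratio_prod a b m) * v - RtoC (ratio_prod a b (S m)) * (w * v)))%C).
  { intros m v. rewrite RtoC_plus.
    replace (RtoC (ratio_prod a b (S m))) with
      (RtoC (ratio_prod a b m) * (RtoC (INR (S m)) + RtoC (a / 2 - b)) /
       (RtoC (INR (S m)) + RtoC a))%C
      by (rewrite <- Hrec; field; apply Hne).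
    field. apply Hne. }
  induction N as [|N IH].
  - rewrite !sum_O. etransitivity; [exact (Hstep O (w ^ 0)%C)|].
    replace (ratio_prod a b 0) with 1 by (unfold ratio_prod, prod_nat; reflexivity).
    simpl Cpow. ring.
  - rewrite !sum_Sn.
    change (@plus C_R_NormedModule) with Cplus.
    transitivity (w * (1 - RtoC (ratio_prod a b (S N)) * w ^ S N) +
            w * (RtoC (ratio_prod a b (S N)) * w ^ S N -
                 RtoC (ratio_prod a b (S (S N))) * (w * w ^ S N)))%C.
    + rewrite <- IH, <- (Hstep (S N)).
      change (w ^ S (S N))%C with (w * w ^ S N)%C. ring.
    + change (w ^ S (S N))%C with (w * w ^ S N)%C. ring.
Qed.

Lemma is_derive_partial_sum (a b t : R) (N : nat) :
  -1 < a ->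
  let w := one_minus_phase t in
  is_derive (V := C_R_NormedModule) (partial_sum a b N) t
    (2 * Ci * (1 - w) *
     sum_n (G := C_R_NormedModule) (fun m => RtoC (INR (S m)) * w ^ m *
        (RtoC (ratio_prod a b m) / RtoC (INR (S m) + a)))%C N)%C.
Proof.
  intros Ha w.
  assert (Hterm : forall m, is_derive (V := C_R_NormedModule)
    (fun s => series_term a b s m) t
    (2 * Ci * (1 - w) * (RtoC (INR (S m)) * w ^ m *
        (RtoC (ratio_prod a b m) / RtoC (INR (S m) + a))))%C).
  { intros m. unfold series_term, Cdiv.
    eapply is_derive_eq_value.
    - apply is_derive_Cmult; [apply is_derive_Cmult|].
      + apply is_derive_Cpow, is_derive_one_minus_phase.
      + apply (is_derive_const (V := C_R_NormedModule)).
      + apply (is_derive_const (V := C_R_NormedModule)).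
    - fold w. C_equation. ring. }
  induction N as [|N IH].
  - rewrite sum_O. apply (is_derive_ext (fun s => series_term a b s 0)).
    + intros s. symmetry. apply (sum_O (G := C_R_NormedModule)).
    + apply Hterm.
  - rewrite sum_Sn.
    apply (is_derive_ext (fun s => plus (partial_sum a b N s : C_R_NormedModule)
                                        (series_term a b s (S N)))).
    + intros s. symmetry. apply (sum_Sn (G := C_R_NormedModule)).
    + eapply is_derive_eq_value.
      * apply (is_derive_plus (V := C_R_NormedModule)); [exact IH | apply Hterm].
      * C_equation. ring.
Qed.

Lemma is_derive_weight (a b z t : R) :
  0 < sin t -> 0 < sin z ->
  is_derive (V := C_R_NormedModule) (weight a b z) t
    ((RtoC a * RtoC (cos t / sin t) + 2 * Ci * RtoC b) * weight a b z t)%C.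
Proof.
  intros Ht Hz. unfold weight.
  eapply is_derive_eq_value.
  - apply is_derive_Cmult.
    + apply is_derive_RtoC. auto_derive.
      * apply Rdiv_lt_0_compat; assumption.
      * reflexivity.
    + apply is_derive_Cexp, is_derive_Cmult; [apply (is_derive_const (V := C_R_NormedModule))|].
      apply is_derive_RtoC. auto_derive; [exact I | reflexivity].
  - C_equation.
    replace (a * (1 * cos t * / sin z * / (sin t * / sin z)) *
      exp (a * ln (sin t * / sin z)))
      with (a * (cos t / sin t) * exp (a * ln (sin t / sin z)))
      by (unfold Rdiv; field; lra).
    rewrite !RtoC_mult. ring.
Qed.

(** The weight is an integrating factor.  The factor [/ (2i)] makes the
    derivative a perturbation of the integrand itself. *)
Lemma is_derive_partial_sum_weight (a b z t : R) (N : nat) :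
  -1 < a -> 0 < sin t -> 0 < sin z ->
  is_derive (V := C_R_NormedModule)
    (fun s => / (2 * Ci) * (partial_sum a b N s * weight a b z s))%C t
    (weight a b z t * (1 - tail_factor a b t N))%C.
Proof.
  intros Ha Ht Hz.
  eapply is_derive_eq_value.
  - apply is_derive_Cmult; [apply (is_derive_const (V := C_R_NormedModule))|].
    apply is_derive_Cmult; [apply is_derive_partial_sum, Ha | apply is_derive_weight; assumption].
  - C_equation.
    pose proof (partial_sum_identity a b t N Ha) as Hid. cbv zeta in Hid.
    pose proof (one_minus_phase_cot t ltac:(lra)) as Hcot.
    pose proof (one_minus_phase_neq_0 t Ht) as Hw.
    set (w := one_minus_phase t) in *.
    set (D := sum_n _ N) in *. set (P := partial_sum a b N t) in *.
    set (E := weight a b z t). set (r := tail_factor a b t N) in *.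
    assert (HCi : (Ci <> 0)%C).
    { intros H. apply (f_equal Im) in H. simpl in H. lra. }
    replace (RtoC (cos t / sin t)) with (2 * Ci / w - Ci)%C.
    2: { rewrite <- Hcot. field. exact Hw. }
    rewrite RtoC_minus, RtoC_div in Hid by lra.
    replace (1 - r)%C with (/ w * (w * (1 - r)))%C by (field; exact Hw).
    rewrite <- Hid.
    field. split; assumption.
Qed.

Lemma Cmod_Cexp (w : C) : Cmod (Cexp w) = exp (Re w).
Proof.
  unfold Cexp, Cmod; simpl. generalize (Im w), (Re w); intros y x.
  replace (_ + _) with ((exp x)² * ((sin y)² + (cos y)²)) by (unfold Rsqr; ring).
  rewrite sin2_cos2, Rmult_1_r. apply sqrt_Rsqr. left; apply exp_pos.
Qed.

Lemma Cmod_weight (a b z t : R) : Cmod (weight a b z t) = exp (a * ln (sin t / sin z)).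
Proof.
  unfold weight. rewrite Cmod_mult, Cmod_R, Rabs_pos_eq, Cmod_Cexp by (left; apply exp_pos).
  replace (Re _) with 0 by (simpl; ring). rewrite exp_0. ring.
Qed.

(** The partial sums have no constant term and [|w| = 2 sin t <= 1] on the range
    considered, so every power of [w] is dominated by [|w|]. *)
Lemma Cmod_partial_sum_bound (a b : R) (N : nat) :
  exists K, 0 <= K /\ forall t, 0 <= sin t <= 1 / 2 ->
    Cmod (partial_sum a b N t) <= K * sin t.
Proof.
  assert (Hterm : forall m, exists K, 0 <= K /\ forall t, 0 <= sin t <= 1 / 2 ->
    Cmod (series_term a b t m) <= K * sin t).
  { intros m.
    set (k := (/ RtoC (INR (S m) + a) * RtoC (ratio_prod a b m))%C).
    exists (2 * Cmod k). split; [generalize (Cmod_ge_0 k); lra|].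
    intros t Ht.
    replace (series_term a b t m) with (one_minus_phase t ^ S m * k)%C
      by (unfold series_term, k, Cdiv; ring).
    rewrite Cmod_mult, Cmod_pow, Cmod_one_minus_phase by lra.
    assert (Hp : (2 * sin t) ^ S m <= 2 * sin t).
    { rewrite <- (Rmult_1_r (2 * sin t)) at 2. simpl.
      apply Rmult_le_compat_l; [lra|].
      rewrite <- (pow1 m). apply pow_incr. lra. }
    generalize (Rmult_le_compat_r (Cmod k) _ _ (Cmod_ge_0 k) Hp). lra. }
  induction N as [|N [K [HK IH]]].
  - destruct (Hterm O) as [K [HK H]]. exists K. split; [exact HK|].
    intros t Ht. unfold partial_sum. rewrite sum_O. apply H, Ht.
  - destruct (Hterm (S N)) as [K' [HK' H]]. exists (K + K'). split; [lra|].
    intros t Ht. unfold partial_sum. rewrite sum_Sn.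
    eapply Rle_trans; [apply Cmod_triangle|].
    specialize (IH t Ht). specialize (H t Ht). unfold partial_sum in IH. lra.
Qed.

(** * Behaviour at the endpoint 0 *)

Lemma filterlim_sin_ratio_power (c z : R) :
  0 < c -> 0 < sin z ->
  filterlim (fun t => exp (c * ln (sin t / sin z))) (at_right 0) (locally 0).
Proof.
  intros Hc Hz.
  apply (filterlim_comp _ _ _ (fun t => c * ln (sin t / sin z)) exp
           _ (Rbar_locally m_infty)).
  2: exact is_lim_exp_m.
  apply (filterlim_comp _ _ _ (fun t => ln (sin t / sin z)) (fun x => c * x)
           _ (Rbar_locally m_infty)).
  2: { intros P [M HM]. exists (M / c). intros x Hx. apply HM.
       apply (Rmult_lt_compat_l c) in Hx; [|exact Hc].
       replace (c * (M / c)) with M in Hx by (field; lra). exact Hx. }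
  apply (filterlim_comp _ _ _ (fun t => sin t / sin z) ln _ (at_right 0)).
  2: exact is_lim_ln_0.
  intros P HP.
  assert (Hcont : filterlim (fun t => sin t / sin z) (at_right 0) (locally 0)).
  { assert (H0 : continuous (fun t => sin t / sin z) 0)
      by (apply (ex_derive_continuous (fun t => sin t / sin z)); auto_derive; exact I).
    unfold continuous in H0. rewrite sin_0 in H0.
    replace (0 / sin z) with 0 in H0 by (field; lra).
    intros Q HQ. apply filter_le_within. exact (H0 Q HQ). }
  assert (Hpos : at_right 0 (fun t => 0 < sin t / sin z)).
  { exists (mkposreal PI PI_RGT_0). intros y Hy Hy0.
    apply Rabs_lt_between' in Hy. simpl in Hy.
    apply Rdiv_lt_0_compat; [apply sin_gt_0; lra | exact Hz]. }
  generalize (filter_and _ _ (Hcont _ HP) Hpos).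
  unfold filtermap. apply filter_imp. intros y [H1 H2]. apply H1, H2.
Qed.

Lemma is_derive_sin_ratio_power (c z t : R) :
  0 < sin t -> 0 < sin z ->
  is_derive (fun s => exp (c * ln (sin s / sin z))) t
    (exp (c * ln (sin t / sin z)) * (c * (cos t / sin t))).
Proof.
  intros Ht Hz. auto_derive.
  - apply Rdiv_lt_0_compat; assumption.
  - unfold Rdiv. field. lra.
Qed.

(** For every [a > -1], of either sign, [(sin t / sin z)^a] is bounded by
    [cos t / cos z] times itself, which is the derivative of
    [k (sin t / sin z)^(1 + a)]. *)
Lemma ex_RInt_gen_sin_ratio_power {V : CompleteNormedModule R_AbsRing} (f : R -> V)
    (a z : R) :
  -1 < a -> 0 < z < PI / 2 ->
  (forall t, 0 < t <= z -> continuous f t) ->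
  (forall t, 0 < t <= z -> norm (f t) <= exp (a * ln (sin t / sin z))) ->
  ex_RInt_gen f (at_right 0) (at_point z).
Proof.
  intros Ha Hz Hf Hle.
  assert (Hsin : forall t, 0 < t <= z -> 0 < sin t) by (intros; apply sin_gt_0; lra).
  assert (Hsz := Hsin z ltac:(lra)).
  assert (Hcos : forall t, 0 < t <= z -> 0 < cos z <= cos t).
  { intros t Ht. split; [apply cos_gt_0; lra | apply cos_decr_1; lra]. }
  assert (Hcz := proj1 (Hcos z ltac:(lra))).
  (* The constant for which the derivative of [k * (sin t / sin z)^(1 + a)] is
     exactly [(sin t / sin z)^a * cos t / cos z]. *)
  set (k := sin z / ((1 + a) * cos z)).
  apply (ex_RInt_gen_dominated f
    (fun t => k * exp ((1 + a) * ln (sin t / sin z)))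
    (fun t => k * (exp ((1 + a) * ln (sin t / sin z)) * ((1 + a) * (cos t / sin t))))
    0 z (k * 0)); try assumption.
  - lra.
  - intros t Ht. apply is_derive_scal, is_derive_sin_ratio_power; auto.
  - intros t Ht. apply (ex_derive_continuous (K := R_AbsRing) (V := R_NormedModule)).
    specialize (Hsin t Ht). auto_derive.
    repeat split; try lra. apply Rdiv_lt_0_compat; assumption.
  - intros t Ht. apply Rle_trans with (1 := Hle t Ht).
    specialize (Hsin t Ht). specialize (Hcos t Ht).
    replace ((1 + a) * ln (sin t / sin z))
      with (a * ln (sin t / sin z) + ln (sin t / sin z)) by ring.
    rewrite exp_plus, exp_ln by (apply Rdiv_lt_0_compat; assumption).
    replace (k * _) with (exp (a * ln (sin t / sin z)) * (cos t / cos z))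
      by (unfold k; field; lra).
    rewrite <- (Rmult_1_r (exp _)) at 1.
    apply Rmult_le_compat_l; [left; apply exp_pos|].
    apply Rle_div_r; lra.
  - apply (filterlim_comp _ _ _ (fun t => exp ((1 + a) * ln (sin t / sin z)))
             (fun x => k * x) _ (locally 0)).
    + apply filterlim_sin_ratio_power; lra.
    + apply (filterlim_scal_r (K := R_AbsRing) (V := R_NormedModule) k 0).
Qed.

(** The partial sum is [O (sin t)] and the weight is of order [(sin t)^a], so
    their product is [O ((sin t)^(1 + a))]. *)
Lemma filterlim_partial_sum_weight (a b z : R) (N : nat) :
  -1 < a -> 0 < sin z ->
  filterlim (fun t => / (2 * Ci) * (partial_sum a b N t * weight a b z t))%C
    (at_right 0) (locally (T := C_R_NormedModule) (RtoC 0)).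
Proof.
  intros Ha Hz.
  destruct (Cmod_partial_sum_bound a b N) as [K [HK Hb]].
  assert (Hlim := filterlim_sin_ratio_power (1 + a) z ltac:(lra) Hz).
  apply (filterlim_locally (F := at_right 0)). intros eps.
  (* The [+ 1] keeps the factor positive when [K = 0]. *)
  assert (Hlim' : at_right 0 (fun t =>
    Rabs (exp ((1 + a) * ln (sin t / sin z))) * (K * sin z + 1) < eps)).
  { assert (Hd : 0 < eps / (K * sin z + 1))
      by (apply Rdiv_lt_0_compat; [apply cond_pos | nra]).
    generalize (proj1 (filterlim_locally _ _) Hlim (mkposreal _ Hd)).
    apply filter_imp. intros t Ht.
    change (Rabs (exp ((1 + a) * ln (sin t / sin z)) - 0) < eps / (K * sin z + 1)) in Ht.
    rewrite Rminus_0_r in Ht. apply Rlt_div_r in Ht; [exact Ht | nra]. }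
  assert (Hnear : at_right 0 (fun t => 0 < sin t <= 1 / 2)).
  { assert (HP := PI_RGT_0).
    exists (mkposreal (PI / 6) ltac:(lra)). intros y Hy Hy0.
    apply Rabs_lt_between' in Hy. simpl in Hy. split.
    - apply sin_gt_0; lra.
    - rewrite <- sin_PI6. apply sin_incr_1; lra. }
  generalize (filter_and _ _ Hlim' Hnear). apply filter_imp. intros t [H1 H2].
  apply (norm_compat1 (V := C_R_NormedModule)).
  rewrite norm_C_R.
  replace (minus _ _) with (/ (2 * Ci) * (partial_sum a b N t * weight a b z t))%C.
  2: { symmetry. apply (minus_zero_r (G := C_R_NormedModule)). }
  apply Rle_lt_trans with (2 := H1).
  rewrite !Cmod_mult, Cmod_weight, Cmod_inv, Cmod_mult, Cmod_Ci, Cmod_R.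
  2: { intros H. apply (f_equal Im) in H. simpl in H. lra. }
  rewrite (Rabs_pos_eq 2), (Rabs_pos_eq (exp _)) by (lra || (left; apply exp_pos)).
  replace ((1 + a) * ln (sin t / sin z))
    with (ln (sin t / sin z) + a * ln (sin t / sin z)) by ring.
  rewrite exp_plus, exp_ln by (apply Rdiv_lt_0_compat; lra).
  specialize (Hb t ltac:(lra)).
  generalize (exp_pos (a * ln (sin t / sin z))). intros HE.
  set (E := exp (a * ln (sin t / sin z))) in *.
  assert (H3 : sin t <= sin t / sin z * sin z) by (right; field; lra).
  assert (H4 : 0 < sin t / sin z) by (apply Rdiv_lt_0_compat; lra).
  apply Rle_trans with (Cmod (partial_sum a b N t) * E).
  - generalize (Rmult_le_pos _ _ (Cmod_ge_0 (partial_sum a b N t)) (Rlt_le _ _ HE)).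
    replace (/ (2 * 1)) with (1 / 2) by field. lra.
  - replace (sin t / sin z * E * (K * sin z + 1)) with ((K * sin t + sin t / sin z) * E)
      by (field; lra).
    apply Rmult_le_compat_r; lra.
Qed.

(** * Decay of the error *)

(** The ratio test for sequences in multiplicative form, so that terms may
    vanish: here [p_m] is eventually [0] whenever [b - a/2] is a positive
    integer. *)
Lemma is_lim_seq_ratio_lt_1 (x q : nat -> R) (l : R) :
  (forall n, x (S n) = x n * q n) -> is_lim_seq q l -> 0 <= l < 1 -> is_lim_seq x 0.
Proof.
  intros Hx Hq Hl.
  set (theta := (1 + l) / 2).
  assert (Hev : eventually (fun n => Rabs (q n) <= theta)).
  { apply is_lim_seq_spec in Hq.
    destruct (Hq (mkposreal ((1 - l) / 2) ltac:(lra))) as [n0 H]. exists n0. intros n Hn.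
    specialize (H n Hn). simpl in H. apply Rabs_lt_between' in H.
    apply Rabs_le. unfold theta. lra. }
  destruct Hev as [n0 Hn0].
  apply (is_lim_seq_incr_n x n0).
  apply is_lim_seq_abs_0.
  apply (is_lim_seq_le_le (fun _ => 0) _ (fun n => Rabs (x n0) * theta ^ n)).
  - intros n. split; [apply Rabs_pos|].
    induction n as [|n IH]; [simpl; lra|].
    change (S n + n0)%nat with (S (n + n0)). rewrite Hx, Rabs_mult.
    simpl pow.
    apply Rle_trans with (Rabs (x n0) * theta ^ n * theta); [|lra].
    apply Rmult_le_compat; try apply Rabs_pos; [exact IH | apply Hn0; lia].
  - apply is_lim_seq_const.
  - replace (Finite 0) with (Rbar_mult (Rabs (x n0)) 0) by (simpl; f_equal; ring).
    apply is_lim_seq_scal_l. apply is_lim_seq_geom. apply Rabs_def1; unfold theta; lra.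
Qed.

Lemma is_lim_seq_ratio_prod_pow (a b y : R) :
  -1 < a -> 0 <= y < 1 -> is_lim_seq (fun m => ratio_prod a b m * y ^ m) 0.
Proof.
  intros Ha Hy.
  apply (is_lim_seq_ratio_lt_1 _
    (fun m => y + (- b - a / 2) * y * / (INR (S m) + a)) y); [| |exact Hy].
  - intros m. rewrite ratio_prod_S. simpl pow. field. apply INR_S_plus_neq_0, Ha.
  - apply (is_lim_seq_plus _ _ y 0); [apply is_lim_seq_const| |
      unfold is_Rbar_plus; simpl; f_equal; f_equal; ring].
    replace (Finite 0) with (Rbar_mult ((- b - a / 2) * y) 0) by (simpl; f_equal; ring).
    apply is_lim_seq_scal_l.
    apply (is_lim_seq_inv _ p_infty); [|discriminate].
    apply (is_lim_seq_plus _ _ p_infty a); [|apply is_lim_seq_const|reflexivity].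
    apply (is_lim_seq_incr_1 INR). apply is_lim_seq_INR.
Qed.

Lemma continuous_weight (a b z t : R) :
  0 < sin t -> 0 < sin z -> continuous (U := C_R_NormedModule) (weight a b z) t.
Proof.
  intros Ht Hz. apply (ex_derive_continuous (K := R_AbsRing) (V := C_R_NormedModule)).
  eexists. apply is_derive_weight; assumption.
Qed.

Lemma Cmod_tail_factor (a b t : R) (N : nat) :
  0 <= sin t -> Cmod (tail_factor a b t N) = Rabs (ratio_prod a b (S N)) * (2 * sin t) ^ S N.
Proof.
  intros Ht. unfold tail_factor.
  rewrite Cmod_mult, Cmod_R, Cmod_pow, Cmod_one_minus_phase by exact Ht. reflexivity.
Qed.

(** Both [E] and [E (1 - r_N)] are integrated over [(0, z]], the second one
    through its primitive [S_N E / (2i)]; the difference of the integrands is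
    [E r_N], and [|r_N|] is largest at [z]. *)
Lemma partial_sum_error (a b z A : R) (N : nat) (I : C) :
  -1 < a -> 0 < z < PI / 2 ->
  is_RInt_gen (V := C_R_NormedModule) (weight a b z) (at_right 0) (at_point z) I ->
  is_RInt_gen (fun t => Cmod (weight a b z t)) (at_right 0) (at_point z) A ->
  Cmod (partial_sum a b N z - 2 * Ci * I) <=
    2 * (Rabs (ratio_prod a b (S N)) * (2 * sin z) ^ S N * A).
Proof.
  intros Ha Hz HI HA.
  assert (Hsin : forall t, 0 < t <= z -> 0 < sin t) by (intros; apply sin_gt_0; lra).
  assert (Hsz := Hsin z ltac:(lra)).
  set (rho := Rabs (ratio_prod a b (S N)) * (2 * sin z) ^ S N).
  set (G := fun t => (/ (2 * Ci) * (partial_sum a b N t * weight a b z t))%C).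
  set (g := fun t => (weight a b z t * (1 - tail_factor a b t N))%C).
  assert (Hg : is_RInt_gen (V := C_R_NormedModule) g (at_right 0) (at_point z) (G z)).
  { apply (is_RInt_gen_right (V := C_R_NormedModule) g
             (fun x => minus (G z : C_R_NormedModule) (G x)) 0 z); [lra| |].
    - intros x Hx.
      apply (is_RInt_derive (V := C_R_CompleteNormedModule)); intros t;
        rewrite Rmin_left, Rmax_right by lra; intros Ht.
      + apply is_derive_partial_sum_weight; auto; apply Hsin; lra.
      + apply (ex_derive_continuous (K := R_AbsRing) (V := C_R_NormedModule)).
        eexists. apply is_derive_Cmult.
        * apply is_derive_weight; auto; apply Hsin; lra.
        * apply (is_derive_minus (V := C_R_NormedModule)).
          -- apply (is_derive_const (V := C_R_NormedModule)).
          -- unfold tail_factor. apply is_derive_Cmult.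
             ++ apply (is_derive_const (V := C_R_NormedModule)).
             ++ apply is_derive_Cpow, is_derive_one_minus_phase.
    - assert (Hm : minus (G z : C_R_NormedModule) zero = G z)
        by apply (minus_zero_r (G := C_R_NormedModule)).
      assert (Hc : filterlim (fun y => minus (G z : C_R_NormedModule) y)
                     (locally (T := C_R_NormedModule) zero)
                     (locally (T := C_R_NormedModule) (G z))).
      { intros P HP.
        apply (continuous_minus (V := C_R_NormedModule) (fun _ => G z : C_R_NormedModule)
                 (fun y => y) zero).
        - apply (continuous_const (V := C_R_NormedModule)).
        - apply (continuous_id (U := C_R_NormedModule)).
        - exact (eq_ind_r (fun l => locally (T := C_R_NormedModule) l P) HP Hm). }
      refine (filterlim_comp _ _ _ G _ _ _ _ _ Hc).
      apply filterlim_partial_sum_weight; assumption. }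
  assert (Hnear : at_right 0 (fun x => 0 < x < z)).
  { exists (mkposreal z (proj1 Hz)). intros y Hy Hy0.
    apply Rabs_lt_between' in Hy. simpl in Hy. lra. }
  assert (Hdiff := is_RInt_gen_minus _ _ _ _ HI Hg).
  assert (Hnorm : norm (minus (I : C_R_NormedModule) (G z)) <= rho * A).
  { apply (RInt_gen_norm (V := C_R_CompleteNormedModule) (Fa := at_right 0) (Fb := at_point z)
       (fun t => minus (weight a b z t : C_R_NormedModule) (g t))
       (fun t => rho * Cmod (weight a b z t))).
    - apply (Filter_prod _ _ _ (fun x => 0 < x < z) (fun y => y = z)); [apply Hnear|reflexivity|].
      intros x y Hx ->. simpl. lra.
    - apply (Filter_prod _ _ _ (fun x => 0 < x < z) (fun y => y = z)); [apply Hnear|reflexivity|].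
      intros x y Hx ->. simpl. intros t Ht. rewrite norm_C_R.
      assert (Hst : 0 < sin t) by (apply Hsin; lra).
      replace (minus _ _) with (weight a b z t * tail_factor a b t N)%C.
      2: { change (weight a b z t * tail_factor a b t N =
             weight a b z t - weight a b z t * (1 - tail_factor a b t N))%C. ring. }
      rewrite Cmod_mult, Rmult_comm, Cmod_tail_factor by lra.
      apply Rmult_le_compat_r; [apply Cmod_ge_0|].
      apply Rmult_le_compat_l; [apply Rabs_pos|].
      apply pow_incr. split; [lra|].
      apply Rmult_le_compat_l; [lra|]. apply sin_incr_1; lra.
    - exact Hdiff.
    - exact (is_RInt_gen_scal _ rho _ HA). }
  rewrite norm_C_R in Hnorm.
  assert (HCi : (Ci <> 0)%C).
  { intros H. apply (f_equal Im) in H. simpl in H. lra. }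
  assert (HGz : (partial_sum a b N z = 2 * Ci * G z)%C).
  { unfold G. replace (weight a b z z) with (RtoC 1).
    - field. exact HCi.
    - unfold weight. replace (sin z / sin z) with 1 by (field; lra).
      replace (z - z) with 0 by ring.
      rewrite ln_1, Rmult_0_r, exp_0, Cmult_0_r.
      unfold Cexp; simpl. rewrite exp_0, cos_0, sin_0, !Rmult_1_r.
      apply injective_projections; simpl; ring. }
  replace (partial_sum a b N z - 2 * Ci * I)%C with (- (2 * Ci) * (I - G z))%C
    by (rewrite HGz; ring).
  rewrite Cmod_mult, Cmod_opp, Cmod_mult, Cmod_Ci, Cmod_R, Rabs_pos_eq by lra.
  rewrite Rmult_1_r. apply Rmult_le_compat_l; [lra | exact Hnorm].
Qed.

(** * The theorem *)

Theorem theorem4p1 (a b z : R) (ha : -1 < a < 1) (hz : 0 < z < PI / 6) :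
  exists I : C,
    is_abs_RInt_right
      (fun t : R =>
         (RtoC (exp (a * ln (sin t / sin z))) *
          Cexp (2 * Ci * RtoC b * RtoC (t - z)%R))%C)
      0 z I /\
    is_series (V := C_R_NormedModule)
      (fun m : nat =>
         let n := S m in
         ((1 - Cexp (- (2 * Ci * RtoC z))) ^ n / RtoC (INR n + a)%R *
          RtoC (prod_nat (fun k => (INR k - b + a / 2) / (INR k + a))%R 1 n))%C)
      (2 * Ci * I)%C.
Proof.
  assert (HPI := PI_RGT_0).
  assert (Hsin : forall t, 0 < t <= z -> 0 < sin t) by (intros; apply sin_gt_0; lra).
  assert (Hsz := Hsin z ltac:(lra)).
  assert (Hsz2 : sin z < 1 / 2) by (rewrite <- sin_PI6; apply sin_increasing_1; lra).
  destruct (ex_RInt_gen_sin_ratio_power (V := C_R_CompleteNormedModule) (weight a b z) a z)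
    as [I HI]; try lra.
  { intros t Ht. apply continuous_weight; auto. }
  { intros t Ht. right. etransitivity; [apply norm_C_R | apply Cmod_weight]. }
  destruct (ex_RInt_gen_sin_ratio_power (V := R_CompleteNormedModule)
              (fun t => Cmod (weight a b z t)) a z) as [A HA]; try lra.
  { intros t Ht.
    apply (continuous_ext (fun t => exp (a * ln (sin t / sin z)))).
    - intros s. symmetry. apply Cmod_weight.
    - apply (ex_derive_continuous (K := R_AbsRing) (V := R_NormedModule)).
      eexists. apply is_derive_sin_ratio_power; auto. }
  { intros t Ht. right. rewrite Cmod_weight. apply Rabs_pos_eq. left; apply exp_pos. }
  exists I. split; [split; [exists A; exact HA | exact HI]|].
  change (is_series (V := C_R_NormedModule) (series_term a b z) (2 * Ci * I)%C).
  apply (filterlim_locally (F := eventually)). intros eps.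
  assert (Hrho := is_lim_seq_ratio_prod_pow a b (2 * sin z) ltac:(lra) ltac:(lra)).
  apply is_lim_seq_incr_1, is_lim_seq_abs_0 in Hrho.
  apply (is_lim_seq_scal_l _ (2 * A)) in Hrho.
  simpl in Hrho. rewrite Rmult_0_r in Hrho.
  apply is_lim_seq_spec in Hrho. generalize (Hrho eps).
  apply filter_imp. intros N HN.
  apply (norm_compat1 (V := C_R_NormedModule)). rewrite norm_C_R.
  apply Rle_lt_trans with (1 := partial_sum_error a b z A N I ltac:(lra) ltac:(lra) HI HA).
  apply Rle_lt_trans with (2 := HN). rewrite Rminus_0_r.
  apply Rle_trans with (2 := Rle_abs _). right.
  rewrite Rabs_mult, (Rabs_pos_eq (_ * _)) by (simpl; apply (pow_le (2 * sin z) (S N)); lra).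
  simpl; ring.
Qed.
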